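(* $$\mathbb{H}^\infty[q^*,q]_{\mathrm{her}}=\mathbb{R}[x_0,x_1,x_2,x_3].$$
   Context: $\mathbb{H}$ is the algebra of quaternions $q=x_0+x_1\mathrm{i}+x_2\mathrm{j}+x_3\mathrm{k}$, identified with $(x_0,x_1,x_2,x_3)\in\mathbb{R}^4$, with conjugation $q^*=x_0-x_1\mathrm{i}-x_2\mathrm{j}-x_3\mathrm{k}$. All polynomials are regarded as elements of the algebra $C(\mathbb{H};\mathbb{H})$ of continuous $\mathbb{H}$-valued functions on $\mathbb{H}$, with pointwise operations and involution $f^*(q):=f(q)^*$. Let $\Sigma=\{1,\mathrm{i},\mathrm{j},\mathrm{k}\}$; for a set $F$, $\mathrm{span}_{\mathbb{H}}F$ is the set of finite sums of elements $afb$ with $a,b\in\mathbb{H}$, $f\in F$. For $k\in\mathbb{N}_0$, $$\mathbb{H}^k[q^*,q]=\mathrm{span}_{\mathbb{H}}\{(q^* )^{m_0}q^{n_0}\sigma_1(q^* )^{m_1}q^{n_1}\cdots\sigma_k(q^* )^{m_k}q^{n_k}: m_0,n_0,\dots,m_k,n_k\in\mathbb{N}_0,\ \sigma_1,\dots,\sigma_k\in\Sigma\}$$ (for $k=0$ this is the span of the elements $(q^* )^{m}q^{n}$), and $\mathbb{H}^\infty[q^*,q]=\bigcup_{k=0}^\infty\mathbb{H}^k[q^*,q]$. The hermitian part is $\mathbb{H}^\infty[q^*,q]_{\mathrm{her}}:=\{f\in\mathbb{H}^\infty[q^*,q]: f=f^*\}$. *)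

(* Defs.v *)
From HB Require Import structures.
From mathcomp Require Import all_boot all_order all_algebra.
From mathcomp Require Import all_classical all_reals all_analysis.
From mathcomp Require Import ring.
(* Not imported: the notations of mpoly clash with those of analysis. *)
From mathcomp Require mpoly.

Set Implicit Arguments.
Unset Strict Implicit.
Unset Printing Implicit Defensive.

Import GRing.Theory Num.Theory numFieldNormedType.Exports.
Local Open Scope classical_set_scope.
Local Open Scope ring_scope.

(* The quaternion x0 + x1 i + x2 j + x3 k is the row vector (x0, x1, x2, x3);
   the topology, the addition and the real scaling are those of R^4. *)
Definition quaternion (R : realType) : Type := 'rV[R]_4.

HB.instance Definition _ (R : realType) := NormedModule.on (quaternion R).

Definition mkq (R : realType) (a b c d : R) : quaternion R :=
  \row_(i < 4) tnth [tuple a; b; c; d] i.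

Section Quaternions.
Variable R : realType.
Implicit Types p q r : quaternion R.

Definition x0 q : R := q 0 (inord 0).
Definition x1 q : R := q 0 (inord 1).
Definition x2 q : R := q 0 (inord 2).
Definition x3 q : R := q 0 (inord 3).

Definition mulq p q : quaternion R :=
  mkq (x0 p * x0 q - x1 p * x1 q - x2 p * x2 q - x3 p * x3 q)
      (x0 p * x1 q + x1 p * x0 q + x2 p * x3 q - x3 p * x2 q)
      (x0 p * x2 q - x1 p * x3 q + x2 p * x0 q + x3 p * x1 q)
      (x0 p * x3 q + x1 p * x2 q - x2 p * x1 q + x3 p * x0 q).

Lemma mkqE (a b c d : R) :
  (x0 (mkq a b c d) = a) * (x1 (mkq a b c d) = b) *
  (x2 (mkq a b c d) = c) * (x3 (mkq a b c d) = d).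
Proof. by rewrite /x0 /x1 /x2 /x3 !mxE !(tnth_nth 0) /= !inordK. Qed.

Lemma addqE p q :
  (x0 (p + q) = x0 p + x0 q) * (x1 (p + q) = x1 p + x1 q) *
  (x2 (p + q) = x2 p + x2 q) * (x3 (p + q) = x3 p + x3 q).
Proof. by rewrite /x0 /x1 /x2 /x3 !mxE. Qed.

Lemma quaternionP p q :
  x0 p = x0 q -> x1 p = x1 q -> x2 p = x2 q -> x3 p = x3 q -> p = q.
Proof.
move=> e0 e1 e2 e3; apply/rowP => i; rewrite -(inord_val i).
by case: i => -[|[|[|[|//]]]].
Qed.

Lemma mulqA : associative mulq.
Proof. by move=> p q r; apply: quaternionP; rewrite !mkqE; ring. Qed.

Lemma mul1q : left_id (mkq 1 0 0 0) mulq.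
Proof. by move=> p; apply: quaternionP; rewrite !mkqE; ring. Qed.

Lemma mulq1 : right_id (mkq 1 0 0 0) mulq.
Proof. by move=> p; apply: quaternionP; rewrite !mkqE; ring. Qed.

Lemma mulqDl : left_distributive mulq +%R.
Proof. by move=> p q r; apply: quaternionP; rewrite !(mkqE, addqE); ring. Qed.

Lemma mulqDr : right_distributive mulq +%R.
Proof. by move=> p q r; apply: quaternionP; rewrite !(mkqE, addqE); ring. Qed.

Lemma oneq_neq0 : mkq 1 0 0 0 != 0 :> quaternion R.
Proof.
apply/eqP => /(congr1 x0) /eqP.
by rewrite mkqE /x0 mxE oner_eq0.
Qed.

HB.instance Definition _ := GRing.Zmodule_isNzRing.Build (quaternion R)
  mulqA mul1q mulq1 mulqDl mulqDr oneq_neq0.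

Definition conjq q : quaternion R := mkq (x0 q) (- x1 q) (- x2 q) (- x3 q).

Definition qi : quaternion R := mkq 0 1 0 0.
Definition qj : quaternion R := mkq 0 0 1 0.
Definition qk : quaternion R := mkq 0 0 0 1.

Definition Sigma : set (quaternion R) := [set 1; qi; qj; qk].

(* The ambient algebra C(H; H).  Hinfty and realpoly are defined as sets of
   functions; Hinfty_sub_CHH and realpoly_sub_CHH show that they lie in CHH. *)
Definition CHH : set (quaternion R -> quaternion R) := [set f | continuous f].

Definition conjf (f : quaternion R -> quaternion R) :
  quaternion R -> quaternion R := fun q => conjq (f q).

Definition spanH (F : set (quaternion R -> quaternion R)) :
    set (quaternion R -> quaternion R) :=
  [set g | exists (N : nat) (a b : 'I_N -> quaternion R)
             (f : 'I_N -> quaternion R -> quaternion R),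
           (forall i, F (f i)) /\
           g = (fun q => \sum_(i < N) a i * f i q * b i)].

(* The product is taken in increasing order of l. *)
Definition word (k : nat) (m n : 'I_k.+1 -> nat)
    (sigma : 'I_k -> quaternion R) : quaternion R -> quaternion R :=
  fun q => conjq q ^+ m ord0 * q ^+ n ord0 *
    \prod_(l < k) (sigma l * conjq q ^+ m (lift ord0 l) * q ^+ n (lift ord0 l)).

Definition words (k : nat) : set (quaternion R -> quaternion R) :=
  [set f | exists (m n : 'I_k.+1 -> nat) (sigma : 'I_k -> quaternion R),
           (forall l, Sigma (sigma l)) /\ f = word m n sigma].

Definition Hpoly (k : nat) : set (quaternion R -> quaternion R) :=
  spanH (words k).

Definition Hinfty : set (quaternion R -> quaternion R) :=
  \bigcup_(k in [set: nat]) Hpoly k.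

Definition hermitian_part (A : set (quaternion R -> quaternion R)) :
  set (quaternion R -> quaternion R) := [set f | A f /\ f = conjf f].

(* R[x0, x1, x2, x3], with R embedded in the quaternions as usual. *)
Definition realpoly : set (quaternion R -> quaternion R) :=
  [set f | exists P : mpoly.mpoly 4 R,
           f = (fun q => mkq (mpoly.meval (fun i : 'I_4 => q 0 i) P) 0 0 0)].

Lemma continuous_x (i : 'I_4) : continuous (fun q => q 0 i : R).
Proof. exact: (@coord_continuous R 1 4 0 i). Qed.

Lemma continuous_coord (T : topologicalType) (f : T -> quaternion R) (i : 'I_4) :
  continuous f -> continuous (fun t => f t 0 i : R).
Proof.
move=> cf t.
exact: (@continuous_comp _ _ _ f (fun q => q 0 i : R) _ (cf t) (@continuous_x i _)).
Qed.

Lemma continuous_mkq (T : topologicalType) (a b c d : T -> R) :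
  continuous a -> continuous b -> continuous c -> continuous d ->
  continuous (fun t => mkq (a t) (b t) (c t) (d t)).
Proof.
move=> ca cb cc cd.
pose e i : quaternion R := delta_mx 0 (inord i).
have -> : (fun t => mkq (a t) (b t) (c t) (d t)) =
    (fun t => a t *: e 0%N + b t *: e 1%N + c t *: e 2%N + d t *: e 3%N).
  apply/funext => t; apply: quaternionP; rewrite mkqE /x0 /x1 /x2 /x3 !mxE.
  - by rewrite eqxx -!val_eqE /= !inordK //=; ring.
  - by rewrite eqxx -!val_eqE /= !inordK //=; ring.
  - by rewrite eqxx -!val_eqE /= !inordK //=; ring.
  - by rewrite eqxx -!val_eqE /= !inordK //=; ring.
move=> t; have cZ (f : T -> R) (v : quaternion R) :
    continuous f -> f x *: v @[x --> t] --> f t *: v.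
  by move=> cf; apply: (@cvgZr_tmp R (quaternion R)); exact: cf.
have cD (f g : T -> quaternion R) u v : f x @[x --> t] --> u ->
    g x @[x --> t] --> v -> f x + g x @[x --> t] --> u + v.
  exact: (@cvgD R (quaternion R)).
exact: cD (cD _ _ _ _ (cD _ _ _ _ (cZ _ _ ca) (cZ _ _ cb)) (cZ _ _ cc)) (cZ _ _ cd).
Qed.

Lemma continuous_mulq (T : topologicalType) (f g : T -> quaternion R) :
  continuous f -> continuous g -> continuous (fun t => f t * g t).
Proof.
move=> cf cg.
have cfx i : continuous (fun t => f t 0 i : R).
  exact: (@continuous_coord _ _ i cf).
have cgx i : continuous (fun t => g t 0 i : R).
  exact: (@continuous_coord _ _ i cg).
have cM i j : continuous (fun t => f t 0 i * g t 0 j : R).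
  by move=> t; apply: cvgM; [exact: cfx|exact: cgx].
apply: continuous_mkq => t.
- by apply: cvgB; [apply: cvgB; [apply: cvgB|]|]; exact: cM.
- by apply: cvgB; [apply: cvgD; [apply: cvgD|]|]; exact: cM.
- by apply: cvgD; [apply: cvgD; [apply: cvgB|]|]; exact: cM.
- by apply: cvgD; [apply: cvgB; [apply: cvgD|]|]; exact: cM.
Qed.

Lemma continuous_expq (T : topologicalType) (f : T -> quaternion R) (n : nat) :
  continuous f -> continuous (fun t => f t ^+ n).
Proof.
move=> cf; elim: n => [|n IHn].
  by under eq_fun do rewrite expr0; exact: cst_continuous.
by under eq_fun do rewrite exprS; exact: continuous_mulq.
Qed.

Lemma continuous_conjq : continuous conjq.
Proof.
have cN i : continuous (fun q => - q 0 i : R).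
  move=> q; apply: (@continuous_comp _ _ _ (fun q => q 0 i : R) -%R).
    exact: continuous_x.
  exact: opp_continuous.
by apply: continuous_mkq; [exact: continuous_x|exact: cN|exact: cN|exact: cN].
Qed.

Lemma continuous_word (k : nat) (m n : 'I_k.+1 -> nat)
    (sigma : 'I_k -> quaternion R) : continuous (word m n sigma).
Proof.
have cid : continuous (@id (quaternion R)) by move=> q; exact: cvg_id.
have cc := continuous_conjq.
apply: continuous_mulq.
  by apply: continuous_mulq; apply: continuous_expq.
apply: continuous_big => [|l _].
  by apply: continuous_mulq; move=> t; [exact: cvg_fst|exact: cvg_snd].
apply: continuous_mulq; last exact: continuous_expq.
by apply: continuous_mulq; [exact: cst_continuous|exact: continuous_expq].
Qed.

Lemma Hinfty_sub_CHH : Hinfty `<=` CHH.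
Proof.
move=> _ [k _ [N [a [b [f [wf ->]]]]]].
apply: continuous_big => [|i _]; first exact: add_continuous.
apply: continuous_mulq; last exact: cst_continuous.
apply: continuous_mulq; first exact: cst_continuous.
by have [m [n [sigma [_ ->]]]] := wf i; exact: continuous_word.
Qed.

Lemma realpoly_sub_CHH : realpoly `<=` CHH.
Proof.
move=> _ [P ->]; apply: continuous_mkq; try exact: cst_continuous.
rewrite /mpoly.meval /mpoly.mmap /mpoly.mmap1.
apply: continuous_big => [|m _ q]; first exact: add_continuous.
apply: (@continuousM _ (quaternion R)); first exact: cst_continuous.
move: q; apply: continuous_big => [|i _]; first exact: mul_continuous.
elim: (mpoly.fun_of_multinom m i) => [|n IHn]; first exact: cst_continuous.
under eq_fun do rewrite exprS.
by move=> q; apply: (@continuousM _ (quaternion R));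
  [exact: continuous_x|exact: IHn].
Qed.

End Quaternions.

(* Main.v *)
(* The coordinates of a product of quaternions are bilinear in the coordinates
   of the factors, so every element of H^oo[q^*, q] has polynomial coordinates,
   and a hermitian one is its own zeroth coordinate.  Conversely the coordinate
   x_l is the real part of s^* q, where s = 1, i, j, k is the l-th unit:
   x_l = (s^* q + q^* s) / 2.  Being central, x_l can be inserted right after a
   word w, before the right coefficient, which turns w into the two words
   w s q and w 1 q^*. *)
Require Import Defs.
From mathcomp Require Import reals.
From mathcomp Require Import all_boot all_algebra boolp classical_sets ring.
From mathcomp Require mpoly.
(* The notations of mpoly clash with those of analysis. *)
Import (canonicals) mpoly.

Set Implicit Arguments.
Unset Strict Implicit.
Unset Printing Implicit Defensive.

Import GRing.Theory Num.Theory.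
Local Open Scope classical_set_scope.
Local Open Scope ring_scope.

(** * Real quaternions and coordinates as quaternionic expressions *)

Section RealQuaternions.
Variable R : realType.
Implicit Types (c d e : R) (p q : quaternion R).

Definition realq c : quaternion R := mkq c 0 0 0.

Lemma oneqE : 1 = mkq 1 0 0 0 :> quaternion R.
Proof. by []. Qed.

(* Unqualified, mulq is the multiplication of rat. *)
Lemma mulqE p q : p * q = Defs.mulq p q.
Proof. by []. Qed.

Lemma realqC c q : realq c * q = q * realq c.
Proof. by rewrite !mulqE; apply: quaternionP; rewrite !mkqE; ring. Qed.

Lemma realqD c d : realq (c + d) = realq c + realq d.
Proof. by apply: quaternionP; rewrite !(mkqE, addqE); ring. Qed.

Lemma realqM c d : realq (c * d) = realq c * realq d.
Proof. by rewrite mulqE; apply: quaternionP; rewrite !mkqE; ring. Qed.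

Lemma conjq_fixed q : q = conjq q -> q = realq (x0 q).
Proof.
have N0 c : c = - c -> c = 0 by move=> /esym/eqP; rewrite eqNr => /eqP.
move=> e; apply: quaternionP; rewrite mkqE //.
- by apply: N0; rewrite {1}e mkqE.
- by apply: N0; rewrite {1}e mkqE.
- by apply: N0; rewrite {1}e mkqE.
Qed.

(** The letters of a word must come from [Sigma], so the formula uses [s] where [s^*] would occur
    and [e] absorbs the sign: [s^* / 2 = e s], with [e = 1/2] for [s = 1] and [e = -1/2] for the
    imaginary units. *)
Lemma coordq_unit (i : 'I_4) : exists s e, Sigma s /\ forall q,
  realq (q 0 i) = realq e * (s * q) + conjq q * (s * realq 2^-1).
Proof.
rewrite -(inord_val i); case: i => -[|[|[|[|//]]]] _ /=.
- exists 1, 2^-1; split; first by left; left; left.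
  move=> q; rewrite -/(x0 q) oneqE !mulqE.
  by apply: quaternionP; rewrite !(mkqE, addqE); field.
- exists (qi R), (- 2^-1); split; first by left; left; right.
  move=> q; rewrite -/(x1 q) !mulqE.
  by apply: quaternionP; rewrite !(mkqE, addqE); field.
- exists (qj R), (- 2^-1); split; first by left; right.
  move=> q; rewrite -/(x2 q) !mulqE.
  by apply: quaternionP; rewrite !(mkqE, addqE); field.
- exists (qk R), (- 2^-1); split; first by right.
  move=> q; rewrite -/(x3 q) !mulqE.
  by apply: quaternionP; rewrite !(mkqE, addqE); field.
Qed.

End RealQuaternions.

(** * Quaternionic functions with polynomial coordinates *)

Section PolynomialCoordinates.
Variable R : realType.
Implicit Types (g h : quaternion R -> R) (f : quaternion R -> quaternion R).

Definition polyfun g :=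
  exists P : mpoly.mpoly 4 R, forall q, g q = mpoly.meval (fun i => q 0 i) P.

Lemma polyfun_cst (c : R) : polyfun (fun=> c).
Proof. by exists (mpoly.mpolyC 4 c) => q; rewrite mpoly.mevalC. Qed.

Lemma polyfun_coord i : polyfun (fun q => q 0 i).
(* Unification with [mevalXU] supplies the witness, the [i]-th variable. *)
Proof. by eexists => q; rewrite -[LHS](mpoly.mevalXU (fun i => q 0 i)). Qed.

Lemma polyfunD g h : polyfun g -> polyfun h -> polyfun (fun q => g q + h q).
Proof. by move=> [P gP] [Q hQ]; exists (P + Q) => q; rewrite mpoly.mevalD gP hQ. Qed.

Lemma polyfunM g h : polyfun g -> polyfun h -> polyfun (fun q => g q * h q).
Proof. by move=> [P gP] [Q hQ]; exists (P * Q) => q; rewrite mpoly.mevalM gP hQ. Qed.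

Lemma polyfunN g : polyfun g -> polyfun (fun q => - g q).
Proof. by move=> [P gP]; exists (- P) => q; rewrite mpoly.mevalN gP. Qed.

Definition polyqfun f :=
  [/\ polyfun (fun q => x0 (f q)), polyfun (fun q => x1 (f q)),
      polyfun (fun q => x2 (f q)) & polyfun (fun q => x3 (f q))].

Lemma polyqfun_mkq g0 g1 g2 g3 :
  polyfun g0 -> polyfun g1 -> polyfun g2 -> polyfun g3 ->
  polyqfun (fun q => mkq (g0 q) (g1 q) (g2 q) (g3 q)).
Proof. by move=> ? ? ? ?; split; under eq_fun do rewrite mkqE. Qed.

Lemma polyqfun_id : polyqfun id.
Proof. by split; exact: polyfun_coord. Qed.

Lemma polyqfun_cst (a : quaternion R) : polyqfun (fun=> a).
Proof. by split; exact: polyfun_cst. Qed.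

Lemma polyqfun_conjq : polyqfun (@conjq R).
Proof.
by apply: polyqfun_mkq; [|apply: polyfunN..]; exact: polyfun_coord.
Qed.

Lemma polyqfunD f f' :
  polyqfun f -> polyqfun f' -> polyqfun (fun q => f q + f' q).
Proof.
move=> [? ? ? ?] [? ? ? ?].
by split; under eq_fun do rewrite addqE; exact: polyfunD.
Qed.

Lemma polyqfunM f f' :
  polyqfun f -> polyqfun f' -> polyqfun (fun q => f q * f' q).
Proof.
by move=> [? ? ? ?] [? ? ? ?]; apply: polyqfun_mkq;
  do ![apply: polyfunD | apply: polyfunN | apply: polyfunM].
Qed.

Lemma polyqfunX f n : polyqfun f -> polyqfun (fun q => f q ^+ n).
Proof.
move=> pf; elim: n => [|n IHn]; first exact: polyqfun_cst.
by under eq_fun do rewrite exprS; exact: polyqfunM.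
Qed.

Lemma polyqfun_sum (I : Type) (r : seq I) (F : I -> quaternion R -> quaternion R) :
  (forall i, polyqfun (F i)) -> polyqfun (fun q => \sum_(i <- r) F i q).
Proof.
move=> pF; elim: r => [|i r IHr].
  by under eq_fun do rewrite big_nil; exact: polyqfun_cst.
by under eq_fun do rewrite big_cons; exact: polyqfunD.
Qed.

Lemma polyqfun_prod (I : Type) (r : seq I) (F : I -> quaternion R -> quaternion R) :
  (forall i, polyqfun (F i)) -> polyqfun (fun q => \prod_(i <- r) F i q).
Proof.
move=> pF; elim: r => [|i r IHr].
  by under eq_fun do rewrite big_nil; exact: polyqfun_cst.
by under eq_fun do rewrite big_cons; exact: polyqfunM.
Qed.

Lemma polyqfun_word k (m n : 'I_k.+1 -> nat) sigma : polyqfun (word m n sigma).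
Proof.
have pX f j : polyqfun f -> polyqfun (fun q => f q ^+ j) by exact: polyqfunX.
apply: polyqfunM.
  by apply: polyqfunM; apply: pX; [exact: polyqfun_conjq|exact: polyqfun_id].
apply: polyqfun_prod => l; apply: polyqfunM; last exact/pX/polyqfun_id.
by apply: polyqfunM; [exact: polyqfun_cst|exact/pX/polyqfun_conjq].
Qed.

Lemma Hinfty_polyqfun f : Hinfty f -> polyqfun f.
Proof.
move=> [k _ [N [a [b [F [wF ->]]]]]]; apply: polyqfun_sum => i.
apply: polyqfunM; last exact: polyqfun_cst.
apply: polyqfunM; first exact: polyqfun_cst.
by have [m [n [sigma [_ ->]]]] := wF i; exact: polyqfun_word.
Qed.

End PolynomialCoordinates.

(** * Closure and induction for spans *)

Section Spans.
Variables (R : realType) (F : set (quaternion R -> quaternion R)).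
Implicit Types f g : quaternion R -> quaternion R.

Lemma spanH0 : spanH F (fun=> 0).
Proof.
exists 0, (fun=> 0), (fun=> 0), (fun=> id); split; first by case.
by apply/funext => q; rewrite big_ord0.
Qed.

Lemma spanH_gen a b f : F f -> spanH F (fun q => a * f q * b).
Proof.
move=> Ff; exists 1, (fun=> a), (fun=> b), (fun=> f); split=> //.
by apply/funext => q; rewrite big_ord1.
Qed.

Lemma spanHD f g : spanH F f -> spanH F g -> spanH F (fun q => f q + g q).
Proof.
move=> [M [a [b [u [Fu ->]]]]] [N [a' [b' [v [Fv ->]]]]].
(* Concatenation of two finite families; polymorphic because it serves both the coefficients and the
   generators. *)
pose glue T (x : 'I_M -> T) (y : 'I_N -> T) (i : 'I_(M + N)) : T :=
  match fintype.split i with inl j => x j | inr j => y j end.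
have glueL T x y j : @glue T x y (lshift N j) = x j by rewrite /glue (unsplitK (inl j)).
have glueR T x y j : @glue T x y (rshift M j) = y j by rewrite /glue (unsplitK (inr j)).
exists (M + N), (glue _ a a'), (glue _ b b'), (glue _ u v); split.
  by move=> i; rewrite /glue; case: fintype.split.
apply/funext => q; rewrite big_split_ord.
by congr (_ + _); apply: eq_bigr => i _; rewrite ?glueL ?glueR.
Qed.

(** Peeling off the first summand reduces a sum of [N] terms to a generator and a shorter sum. *)
Lemma spanH_ind (P : set (quaternion R -> quaternion R)) :
  P (fun=> 0) ->
  (forall f g, P f -> P g -> P (fun q => f q + g q)) ->
  (forall a b f, F f -> P (fun q => a * f q * b)) -> spanH F `<=` P.
Proof.
move=> P0 PD Pgen _ [N [a [b [u [Fu ->]]]]]; elim: N a b u Fu => [|N IHN] a b u Fu.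
  by under eq_fun do rewrite big_ord0.
under eq_fun do rewrite big_ord_recl.
by apply: PD; [exact: Pgen|exact: IHN].
Qed.

End Spans.

(** * Lengthening words, and real polynomials as elements of the span *)

Section RealPolynomials.
Variable R : realType.
Implicit Types f g : quaternion R -> quaternion R.

(** Appends [y] to the family [x]: [unlift ord_max] is [None] exactly at the last index, where
    [oapp] returns its default [y]. *)
Definition snoc T k (x : 'I_k -> T) (y : T) (i : 'I_k.+1) : T :=
  oapp x y (unlift ord_max i).

Lemma snoc_max T k (x : 'I_k -> T) y : snoc x y ord_max = y.
Proof. by rewrite /snoc unlift_none. Qed.

Lemma snoc_widen T k (x : 'I_k -> T) y l (kS : (k <= k.+1)%N) :
  snoc x y (widen_ord kS l) = x l.
Proof.
suff -> : widen_ord kS l = lift ord_max l by rewrite /snoc liftK.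
by apply: val_inj; rewrite /= /bump leqNgt ltn_ord.
Qed.

(** In [word] the exponents at [ord0] stand apart and the others are reached through [lift ord0];
    this lemma and the next two evaluate [snoc] at such indices. *)
Lemma snoc_0 T k (x : 'I_k.+1 -> T) y : snoc x y ord0 = x ord0.
Proof. by rewrite -(snoc_widen x y _ (leqnSn _)); congr snoc; apply: val_inj. Qed.

Lemma snoc_lift_widen T k (x : 'I_k.+1 -> T) y l (kS : (k <= k.+1)%N) :
  snoc x y (lift ord0 (widen_ord kS l)) = x (lift ord0 l).
Proof. by rewrite -(snoc_widen x y _ (leqnSn _)); congr snoc; apply: val_inj. Qed.

Lemma snoc_lift_max T k (x : 'I_k.+1 -> T) y : snoc x y (lift ord0 ord_max) = y.
Proof. by rewrite -[RHS](snoc_max x); congr snoc; apply: val_inj. Qed.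

Lemma word_snoc k (m n : 'I_k.+1 -> nat) sigma (m' n' : nat) s :
  word (snoc m m') (snoc n n') (snoc sigma s) =
  fun q => word m n sigma q * (s * conjq q ^+ m' * q ^+ n') :> quaternion R.
Proof.
apply/funext => q; rewrite /word big_ord_recr !snoc_0 !snoc_lift_max snoc_max.
by under eq_bigr do rewrite snoc_widen !snoc_lift_widen; rewrite [LHS]mulrA.
Qed.

Lemma words_snoc k f s m n : words k f -> Sigma s ->
  words k.+1 (fun q => f q * (s * conjq q ^+ m * q ^+ n)).
Proof.
move=> [ms [ns [sigma [Ssigma ->]]]] Ss.
exists (snoc ms m), (snoc ns n), (snoc sigma s); split; last by rewrite word_snoc.
by move=> l; rewrite /snoc; case: unliftP => [j _|_]; [exact: Ssigma|exact: Ss].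
Qed.

(** Appending the trivial block with letter [1] and both exponents zero lengthens a word without
    changing its value. *)
Lemma HpolyS k : @Hpoly R k `<=` Hpoly k.+1.
Proof.
apply: spanH_ind; [exact: spanH0|by move=> f g; exact: spanHD|move=> a b f wf].
have -> : f = fun q => f q * (1 * conjq q ^+ 0 * q ^+ 0).
  by apply/funext => q; rewrite !expr0 !mulr1.
by apply/spanH_gen/words_snoc => //; left; left; left.
Qed.

Lemma subset_Hpoly k l : (k <= l)%N -> @Hpoly R k `<=` Hpoly l.
Proof.
by elim: l => [|l IHl]; [rewrite leqn0 => /eqP->|
  rewrite leq_eqVlt => /predU1P[->//|/IHl kl f /kl /HpolyS]].
Qed.

Lemma HinftyD f g : Hinfty f -> Hinfty g -> Hinfty (fun q => f q + g q).
Proof.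
move=> [k _ Hf] [l _ Hg]; exists (maxn k l) => //; apply: spanHD.
- exact: subset_Hpoly (leq_maxl k l) _ Hf.
- exact: subset_Hpoly (leq_maxr k l) _ Hg.
Qed.

Lemma Hinfty_realq (c : R) : Hinfty (fun=> realq c).
Proof.
exists 0%N => //.
have w1 : words 0 (fun=> 1 : quaternion R).
  exists (fun=> 0%N), (fun=> 0%N), (fun=> 1); split; first by case.
  by apply/funext => q; rewrite /word big_ord0 !expr0 !mulr1.
by have := spanH_gen (realq c) 1 w1; under eq_fun do rewrite !mulr1.
Qed.

(** On a generator [a f b] the central factor moves to the left of [b], where [coordq_unit] splits
    it into two terms, each extending the word [f] by one block. *)
Lemma Hpoly_mul_coord k f i :
  Hpoly k f -> Hpoly k.+1 (fun q => f q * realq (q 0 i)).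
Proof.
move: f; apply: spanH_ind.
- by under eq_fun do rewrite mul0r; exact: spanH0.
- by move=> f g Hf Hg; under eq_fun do rewrite mulrDl; exact: spanHD.
move=> a b f wf; have [s [e [Ss coordE]]] := coordq_unit R i.
have S1 : Sigma (1 : quaternion R) by left; left; left.
(* The block is [s q]; the real factor [e] commutes with [f] and joins the left coefficient. *)
have H1 := spanH_gen (a * realq e) b (words_snoc 0 1 wf Ss).
(* The block is [1 q^*]; [s / 2] stands to the right of [q^*] and joins the right coefficient. *)
have H2 := spanH_gen a (s * realq 2^-1 * b) (words_snoc 1 0 wf S1).
congr (spanH _ _): (spanHD H1 H2); apply/funext => q.
rewrite !expr0 !expr1 !mulr1 mul1r -[RHS]mulrA -(realqC (q 0 i)) coordE.
by rewrite mulrDl mulrDr !mulrA -(mulrA a (realq e)) realqC !mulrA.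
Qed.

Lemma Hinfty_mul_coord f i :
  Hinfty f -> Hinfty (fun q => f q * realq (q 0 i)).
Proof. by move=> [k _ Hf]; exists k.+1 => //; exact: Hpoly_mul_coord. Qed.

(** One coordinate is multiplied in at a time: the outer induction runs over the list of variables,
    the inner one over the exponent of the current variable. *)
Lemma Hinfty_mul_monomial f (m : 'I_4 -> nat) : Hinfty f ->
  Hinfty (fun q => f q * realq (\prod_(i < 4) q 0 i ^+ m i)).
Proof.
move=> Hf; elim: (index_enum _) => [|i r IHr].
  by under eq_fun do rewrite big_nil mulr1.
under eq_fun do rewrite big_cons.
elim: (m i) => [|n IHn]; first by under eq_fun do rewrite expr0 mul1r.
by under eq_fun do rewrite exprSr mulrAC realqM mulrA; exact: Hinfty_mul_coord.
Qed.

Lemma Hinfty_meval (P : mpoly.mpoly 4 R) :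
  Hinfty (fun q => realq (mpoly.meval (fun i => q 0 i) P)).
Proof.
elim/mpoly.mpolyind: P => [|c m P _ _ HP].
  by under eq_fun do rewrite mpoly.meval0; exact: Hinfty_realq.
under eq_fun do
  rewrite mpoly.mevalD mpoly.mevalZ mpoly.mevalX realqD realqM.
by apply: HinftyD => //; apply: Hinfty_mul_monomial; exact: Hinfty_realq.
Qed.

End RealPolynomials.

Theorem theorem4p13 (R : realType) :
  hermitian_part (@Hinfty R) = @realpoly R.
Proof.
apply/seteqP; split => [f [Hf fE]|_ [P ->]].
  (* [P] represents the zeroth coordinate of [f], which determines [f] because [f] is fixed by
     conjugation. *)
  have [[P fP] _ _ _] := Hinfty_polyqfun Hf.
  exists P; apply/funext => q; rewrite -fP.
  by apply: conjq_fixed; exact: (congr1 (@^~ q) fE).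
split; first exact: Hinfty_meval.
by apply/funext => q; rewrite /conjf /conjq !mkqE oppr0.
Qed.
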